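(* There exist a velocity field $b \in L^\infty((0,1); L^1(\mathbb{R})) \cap C^\infty([0,1)\times \mathbb{R})$ and a smooth solution $u \in C^\infty([0,1)\times \mathbb{R}) \cap L^2((0,1); L^2(\mathbb{R}))$ of $$\partial_t u + \partial_x(bu) = \partial_{xx} u \quad \text{in } [0,1)\times\mathbb{R},$$ with initial datum $u_0 = u(0,\cdot) \in L^2(\mathbb{R}) \cap L^\infty(\mathbb{R}) \cap C^\infty(\mathbb{R})$, such that $$\limsup_{t\to 1^-} u(t,0) = \infty \qquad \text{and} \qquad \lim_{t\to 1^-} \|u(t,\cdot) \|_{L^2(\mathbb{R})} = \infty .$$
   Context: Both $b=b(t,x)$ and $u=u(t,x)$ are real-valued. For $1\le r,q\le\infty$, $L^r((0,1);L^q(\mathbb{R}))$ is the space of measurable functions $f$ on $(0,1)\times\mathbb{R}$ for which $t\mapsto\|f(t,\cdot)\|_{L^q(\mathbb{R})}$ belongs to $L^r((0,1))$. *)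

(* Defs.v *)
From mathcomp Require Import all_boot all_order all_algebra.
From mathcomp Require Import all_classical all_reals all_analysis.
From mathcomp Require Import measurable_realfun.
Import Order.TTheory GRing.Theory Num.Theory.
Import numFieldNormedType.Exports.

Set Implicit Arguments.
Unset Strict Implicit.
Unset Printing Implicit Defensive.

Local Open Scope classical_set_scope.
Local Open Scope ring_scope.

(* A function on [0,1) x R is represented by a total f : R -> R -> R, written
   f t x; its values for t outside [0,1) are irrelevant to every notion below. *)

Section TimeSpace.
Context {R : realType}.
Implicit Types (f : R -> R -> R) (t x : R).

Definition dom01 : set (R * R) := `[0, 1[ `*` setT.

(* The increment h ranges over those with h + t in [0,1), so that the time
   derivative is the one-sided one at t = 0. *)
Definition time_incr t : set_system R :=
  within [set h : R | 0 <= h + t < 1] 0^'.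

Definition time_quot f t x : R -> R := fun h => h^-1 * (f (h + t) x - f t x).

Definition dt f t x : R := lim (time_quot f t x @ time_incr t).

Definition dx f t x : R := derive1 (f t) x.

(* C^n up to the boundary t = 0. *)
Fixpoint Cn01 (n : nat) f : Prop :=
  {within dom01, continuous (fun p : R * R => f p.1 p.2)} /\
  match n with
  | 0%N => True
  | m.+1 =>
      [/\ forall t x, 0 <= t < 1 -> cvg (time_quot f t x @ time_incr t),
          forall t x, 0 <= t < 1 -> derivable (f t) x 1,
          Cn01 m (dt f)
        & Cn01 m (dx f)]
  end.

Definition smooth01 f : Prop := forall n, Cn01 n f.

Definition smooth (g : R -> R) : Prop :=
  forall n x, derivable (derive1n n g) x 1.

Definition space_norm (q : \bar R) f : R -> \bar R :=
  fun t => Lnorm (@lebesgue_measure R) q (EFin \o f t).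

(* L^r((0,1); L^q(R)) for 1 <= r, q <= +oo. The L^r(0,1) norm of a function of
   t is the L^r(R) norm of its extension by 0. *)
Definition in_LrLq (r q : \bar R) f : Prop :=
  [/\ measurable_fun (`]0, 1[%classic `*` setT : set (R * R)) (fun p : R * R => f p.1 p.2),
      measurable_fun (`]0, 1[%classic : set R) (space_norm q f)
    & (Lnorm (@lebesgue_measure R) r ((space_norm q f) \_ (`]0%R, 1%R[%classic : set R)) < +oo)%E].

End TimeSpace.

(* Main.v *)
Require Import Defs.
From mathcomp Require Import all_boot all_order all_algebra.
From mathcomp Require Import all_classical all_reals all_analysis.
From mathcomp Require Import measurable_realfun ess_sup_inf.
From mathcomp Require Import unstable ring lra.
Set Implicit Arguments.
Unset Strict Implicit.
Unset Printing Implicit Defensive.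
Import Order.TTheory GRing.Theory Num.Theory.
Import numFieldNormedType.Exports.
Local Open Scope classical_set_scope.
Local Open Scope ring_scope.

(** The example is self-similar.  Put [tau = 1 - t] and [s = x ^ 2 + tau].  If
    [U] is a primitive of [u] in space, the equation holds as soon as the flux
    [b u] equals [U_xx - U_t], so any [U] with [U_x > 0] yields a velocity
    [b = (U_xx - U_t) / U_x].  The [L^1] norm of [b] is invariant under the
    parabolic scaling, hence constant in time when
    [U = tau ^ (1 / 2 - a) * Phi (x / sqrt tau)]; the solution is then
    [u = tau ^ (- a) * Phi' (x / sqrt tau)].  It blows up at the origin like
    [tau ^ (- a)], and its squared [L^2] norm is a multiple of
    [tau ^ (1 / 2 - 2 a)], which tends to infinity but remains integrable in
    time when [1 / 4 < a < 3 / 4].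

    The equation makes the profile [Phi'] behave like [|y| ^ (- 2 a)] at
    infinity.  Since a positive solution conserves its mass, which a change of
    scale with [a > 1 / 2] would not, the exponent is taken in [(1 / 4, 1 / 2)].
    Here [a = 3 / 8] and
    [U = 64 x (x ^ 2 + 25 / 16 tau) s ^ (- 11 / 8)].  The exponent makes [U]
    asymptotic to a stationary profile [|x| ^ (1 / 4)], and the constant
    [25 / 16] cancels the next term of the expansion of the flux, which would
    leave in [b] a tail [1 / x] that is not integrable.  Differentiating,
      [u = P s ^ (- 19 / 8)],  [P = 16 x ^ 4 + 17 x ^ 2 tau + 100 tau ^ 2],
      [b u = - 33 / 4 * x tau (x ^ 2 + 58 tau) s ^ (- 27 / 8)].

    The three functions are built from [x] and [tau] with sums, products and
    real powers of positive quantities.  This class is closed under both partial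
    derivatives, which gives smoothness ([Cn01_ev], [smooth_ev]) and reduces the
    equation to a field identity ([pde_terms]).  All norms are compared with
    powers of the parabolic distance [v = |x| + sqrt tau], for which
    [s <= v ^ 2 <= 2 s] and [v ^ (- p - 1)] has an explicit integral
    ([integral_par_dist]): [u ^ 2] is comparable to [v ^ (- 3 / 2)]
    ([sqr_u_bounds]) and [b] is bounded by a multiple of [tau v ^ (- 3)]
    ([b_bound]). *)

(** * Expressions in space and remaining time *)

(** Expressions are kept as syntax so that their partial derivatives, of every
    order, are again given by explicit expressions; [Spc] stands for the space
    variable and [Rem] for the remaining time [1 - t]. *)
Inductive term (R : Type) :=
| Cst of R
| Spc
| Rem
| Add of term R & term R
| Mul of term R & term R
| Pow of term R & R.
Arguments Spc {R}.
Arguments Rem {R}.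

Lemma continuous_powRl {R : realType} (a z : R) : 0 < z ->
  {for z, continuous (fun y => y `^ a)}.
Proof.
move=> z0; apply: differentiable_continuous; apply/derivable1_diffP.
by apply: derivable_powR; rewrite in_itv/= z0.
Qed.

Section Terms.
Context {R : realType}.
Implicit Types (e : term R) (t x a : R).

Fixpoint ev e t x : R :=
  match e with
  | Cst c => c
  | Spc => x
  | Rem => 1 - t
  | Add e1 e2 => ev e1 t x + ev e2 t x
  | Mul e1 e2 => ev e1 t x * ev e2 t x
  | Pow e1 a => ev e1 t x `^ a
  end.

(** The domain condition is required for all [t < 1], negative times included,
    so that time derivatives at [t = 0] are two-sided. *)
Fixpoint pos_bases e : Prop :=
  match e with
  | Add e1 e2 | Mul e1 e2 => pos_bases e1 /\ pos_bases e2
  | Pow e1 a => pos_bases e1 /\ forall t x, t < 1 -> 0 < ev e1 t x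
  | _ => True
  end.

(** [diff dX dT] is the derivative along a curve on which the space variable and
    the remaining time have derivatives [dX] and [dT]; both partial derivatives
    are instances of it. *)
Fixpoint diff (dX dT : R) e : term R :=
  match e with
  | Cst _ => Cst 0
  | Spc => Cst dX
  | Rem => Cst dT
  | Add e1 e2 => Add (diff dX dT e1) (diff dX dT e2)
  | Mul e1 e2 => Add (Mul (diff dX dT e1) e2) (Mul e1 (diff dX dT e2))
  | Pow e1 a => Mul (Mul (Cst a) (Pow e1 (a - 1))) (diff dX dT e1)
  end.

Definition diffx := diff 1 0.
Definition difft := diff 0 (-1).

Lemma pos_bases_diff dX dT e : pos_bases e -> pos_bases (diff dX dT e).
Proof.
elim: e => //= [e1 IH1 e2 IH2|e1 IH1 e2 IH2|e1 IH1 a] [h1 h2].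
- by split; [exact: IH1|exact: IH2].
- by split; split => //; [exact: IH1|exact: IH2].
- by split; [|exact: IH1].
Qed.

Lemma is_derive_ev e (f g : R -> R) dX dT y : pos_bases e -> f y < 1 ->
  is_derive y 1 f (- dT) -> is_derive y 1 g dX ->
  is_derive y 1 (fun z => ev e (f z) (g z)) (ev (diff dX dT e) (f y) (g y)).
Proof.
move=> pe fy1 df dg; elim: e pe => /=.
- by move=> c _; exact: is_derive_cst.
- by [].
- move=> _.
  apply: is_derive_eq (is_deriveB (is_derive_cst (1 : R) y 1) df) _.
  by rewrite sub0r opprK.
- move=> e1 IH1 e2 IH2 [/IH1 h1 /IH2 h2].
  exact: (is_deriveD h1 h2).
- move=> e1 IH1 e2 IH2 [/IH1 h1 /IH2 h2].
  apply: is_derive_eq (is_deriveM h1 h2) _.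
  rewrite /GRing.scale /=; ring.
- move=> e1 IH1 a [/IH1 h1 /(_ _ (g y) fy1) p1].
  apply: is_derive_eq (@is_derive1_comp _ (fun z => z `^ a) _ y _ _
    (is_derive1_powR a p1) h1) _.
  by [].
Qed.

Lemma is_derive_evx e t x : pos_bases e -> t < 1 ->
  is_derive x 1 (ev e t) (ev (diffx e) t x).
Proof.
move=> pe t1.
apply: (@is_derive_ev e (cst t) id 1 0 x) => //.
rewrite oppr0; exact: is_derive_cst.
Qed.

Lemma is_derive_evt e t x : pos_bases e -> t < 1 ->
  is_derive t 1 (fun s => ev e s x) (ev (difft e) t x).
Proof.
move=> pe t1.
apply: (@is_derive_ev e id (cst x) 0 (-1) t) => //.
rewrite opprK; exact: is_derive_id.
Qed.

(** Continuity is joint in both variables, which separate derivability in [t]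
    and in [x] would not give. *)
Lemma continuous_ev e t x : pos_bases e -> t < 1 ->
  {for (t, x), continuous (fun p : R * R => ev e p.1 p.2)}.
Proof.
move=> pe t1; elim: e pe => /=.
- by move=> c _; exact: cst_continuous.
- by move=> _; exact: cvg_snd.
- by move=> _; apply: cvgB; [exact: cvg_cst|exact: cvg_fst].
- by move=> e1 IH1 e2 IH2 [/IH1 h1 /IH2 h2]; exact: cvgD.
- by move=> e1 IH1 e2 IH2 [/IH1 h1 /IH2 h2]; exact: cvgM.
- move=> e1 IH1 a [/IH1 h1 /(_ _ x t1) p1].
  apply: (@continuous_comp _ _ _ (fun p : R * R => ev e1 p.1 p.2)
    (fun z => z `^ a)) => //=.
  exact: continuous_powRl.
Qed.

(** Real powers are total Borel functions, so every expression is measurable on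
    the whole of space-time, beyond the blow-up time as well. *)
Lemma measurable_ev e :
  measurable_fun [set: R * R] (fun p : R * R => ev e p.1 p.2).
Proof.
elim: e => /= [c|||e1 h1 e2 h2|e1 h1 e2 h2|e1 h1 a].
- exact: measurable_cst.
- exact: measurable_snd.
- by apply: measurable_funB; [exact: measurable_cst|exact: measurable_fst].
- exact: measurable_funD.
- exact: measurable_funM.
- exact: (measurableT_comp (measurable_powR a) h1).
Qed.

Lemma cvg_time_quot_ev e t x : pos_bases e -> 0 <= t < 1 ->
  time_quot (ev e) t x @ time_incr t --> ev (difft e) t x.
Proof.
move=> pe /andP[t0 t1].
have [dv <-] := is_derive_evt x pe t1.
apply: cvg_within_filter; rewrite /time_quot.
under eq_fun => h do rewrite -[h in h + t]mulr1.
exact: dv.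
Qed.

(** The half-open interval has no isolated point: this is what makes the limit
    defining [dt] unique, also at [t = 0]. *)
Lemma time_incr_proper t : 0 <= t < 1 -> ProperFilter (time_incr t).
Proof.
move=> /andP[t0 t1]; split; last exact: within_filter.
rewrite /time_incr /within/= => /nbhs_ballP[e /= e0 he].
pose h := Num.min (e / 2) ((1 - t) / 2).
have h0 : 0 < h by rewrite lt_min !divr_gt0// subr_gt0.
have he2 : h <= e / 2 by rewrite ge_min lexx.
have ht : h <= (1 - t) / 2 by rewrite ge_min lexx orbT.
apply: (he h) => /=.
- rewrite /ball/= sub0r normrN gtr0_norm//; lra.
- exact: lt0r_neq0.
- by apply/andP; split; lra.
Qed.

(** Only the values of [f] at times in [[0, 1)] enter, since [dt f] is known to
    be given by an expression only there; the induction on the order of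
    differentiability rests on this. *)
Lemma cvg_time_quot (f : R -> R -> R) e t x : pos_bases e ->
  (forall s y, 0 <= s < 1 -> f s y = ev e s y) -> 0 <= t < 1 ->
  time_quot f t x @ time_incr t --> ev (difft e) t x.
Proof.
move=> pe fe t01; apply: cvg_trans; last exact: cvg_time_quot_ev pe t01.
apply: near_eq_cvg; rewrite /time_incr near_withinE; near=> h => ht.
by rewrite /time_quot !fe.
Unshelve. all: by end_near. Qed.

Lemma dtE (f : R -> R -> R) e t x : pos_bases e ->
  (forall s y, 0 <= s < 1 -> f s y = ev e s y) -> 0 <= t < 1 ->
  dt f t x = ev (difft e) t x.
Proof.
move=> pe fe t01; have := time_incr_proper t01 => ?.
by apply: cvg_lim => //; exact: cvg_time_quot fe t01.
Qed.

Lemma dxE (f : R -> R -> R) e t x : pos_bases e ->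
  (forall s y, 0 <= s < 1 -> f s y = ev e s y) -> 0 <= t < 1 ->
  dx f t x = ev (diffx e) t x.
Proof.
move=> pe fe t01; have ft : f t = ev e t by apply/funext => y; exact: fe.
case/andP: t01 => _ t1.
by rewrite /dx ft derive1E; have [_ ->] := is_derive_evx x pe t1.
Qed.

Lemma Cn01_ev n (f : R -> R -> R) e : pos_bases e ->
  (forall t x, 0 <= t < 1 -> f t x = ev e t x) -> Cn01 n f.
Proof.
have cont f' e' : pos_bases e' ->
    (forall t x, 0 <= t < 1 -> f' t x = ev e' t x) ->
    {within dom01, continuous (fun p : R * R => f' p.1 p.2)}.
  move=> pe fe; apply: (@subspace_eq_continuous _ _ _
    (fun p : R * R => ev e' p.1 p.2)).
    by move=> [t x] /set_mem[/=]; rewrite in_itv/= => t01 _; exact/esym/fe.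
  apply/subspace_continuousP => -[t x] [/=]; rewrite in_itv/= => /andP[_ t1] _.
  by apply: cvg_within_filter; exact: continuous_ev.
elim: n f e => [|n IH] f e pe fe /=; split; [exact: cont fe|by []|exact: cont fe|].
have dxe t x : 0 <= t < 1 -> is_derive x 1 (f t) (ev (diffx e) t x).
  move=> t01; have -> : f t = ev e t by apply/funext => y; exact: fe.
  by case/andP: t01 => _; exact: is_derive_evx.
split.
- move=> t x t01; apply/cvg_ex; exists (ev (difft e) t x).
  exact: cvg_time_quot fe t01.
- by move=> t x /dxe -/(_ x)[].
- apply: (IH _ (difft e)); first exact: pos_bases_diff.
  by move=> t x t01; exact: dtE.
- apply: (IH _ (diffx e)); first exact: pos_bases_diff.
  by move=> t x t01; exact: dxE.
Qed.

Lemma smooth_ev e t : pos_bases e -> t < 1 -> smooth (ev e t).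
Proof.
move=> pe t1 n x.
suff [e' [pe' ->]] : exists e', pos_bases e' /\ derive1n n (ev e t) = ev e' t.
  by have [] := is_derive_evx x pe' t1.
elim: n => [|n [e' [pe' IH]]]; first by exists e.
exists (diffx e'); split; first exact: pos_bases_diff.
rewrite derive1nS IH; apply/funext => y.
by rewrite derive1E; have [_ ->] := is_derive_evx y pe' t1.
Qed.

End Terms.

(** * The velocity field, the solution and the equation *)

Section Solution.
Context {R : realType}.
Implicit Types t x : R.

Definition s_term : term R := Add (Mul Spc Spc) Rem.

Definition P_term : term R :=
  Add (Mul (Cst 16) (Mul (Mul Spc Spc) (Mul Spc Spc)))
    (Add (Mul (Cst 17) (Mul (Mul Spc Spc) Rem))
         (Mul (Cst 100) (Mul Rem Rem))).

Definition u_term : term R := Mul P_term (Pow s_term (- (19 / 8))).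

(** Up to a power of [s], this is the flux [U_xx - U_t]; the monomial [x ^ 5] has
    disappeared from it, thanks to the constant [25 / 16] in [U]. *)
Definition N_term : term R :=
  Mul (Cst (- (33 / 4)))
    (Mul (Mul Spc Rem) (Add (Mul Spc Spc) (Mul (Cst 58) Rem))).

Definition b_term : term R :=
  Mul N_term (Mul (Pow s_term (-1)) (Pow P_term (-1))).

Definition flux_term : term R := Mul N_term (Pow s_term (- (19 / 8) - 1)).

Lemma s_gt0 t x : t < 1 -> 0 < ev s_term t x.
Proof. by move=> t1 /=; nra. Qed.

(** Both bounds on [P] hold coefficient by coefficient in powers of [x ^ 2] and
    [1 - t]. *)
Lemma P_ge t x : t < 1 -> 8 * ev s_term t x ^+ 2 <= ev P_term t x.
Proof.
move=> t1 /=.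
have t0 : 0 <= 1 - t by lra.
have x0 : 0 <= x * x by nra.
move: (1 - t) (x * x) t0 x0 => T X T0 X0; nra.
Qed.

Lemma P_le t x : t < 1 -> ev P_term t x <= 100 * ev s_term t x ^+ 2.
Proof.
move=> t1 /=.
have t0 : 0 <= 1 - t by lra.
have x0 : 0 <= x * x by nra.
move: (1 - t) (x * x) t0 x0 => T X T0 X0; nra.
Qed.

Lemma P_gt0 t x : t < 1 -> 0 < ev P_term t x.
Proof.
move=> t1; apply: lt_le_trans (P_ge x t1).
by rewrite mulr_gt0// exprn_gt0// s_gt0.
Qed.

Lemma u_pos_bases : pos_bases u_term.
Proof. by do !split => //; exact: s_gt0. Qed.

Lemma b_pos_bases : pos_bases b_term.
Proof. by do !split => //; [exact: s_gt0|exact: P_gt0]. Qed.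

Lemma flux_pos_bases : pos_bases flux_term.
Proof. by do !split => //; exact: s_gt0. Qed.

Lemma powRB1 (z a : R) : 0 < z -> z `^ (a - 1) = z `^ a / z.
Proof.
by move=> z0; rewrite powRB ?(gt_eqF z0) ?implybT// powRr1// ltW.
Qed.

Lemma fluxE t x : t < 1 -> ev b_term t x * ev u_term t x = ev flux_term t x.
Proof.
move=> t1; have s0 := s_gt0 x t1; have P0 := P_gt0 x t1.
have -> : ev b_term t x = ev N_term t x *
  (ev s_term t x `^ (-1) * ev P_term t x `^ (-1)) by [].
have -> : ev u_term t x = ev P_term t x * ev s_term t x `^ (- (19 / 8)) by [].
have -> : ev flux_term t x = ev N_term t x * ev s_term t x `^ (- (19 / 8) - 1).
  by [].
move: (ev s_term t x) (ev P_term t x) (ev N_term t x) s0 P0 => s P N s0 P0.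
rewrite powRB1// !powR_inv1 ?ltW//.
by field; rewrite (gt_eqF s0) (gt_eqF P0).
Qed.

(** Lowering every exponent to the common power [s ^ (- 19 / 8)] leaves a
    rational identity in [x], [t] and that power. *)
Lemma pde_terms t x : t < 1 ->
  ev (difft u_term) t x + ev (diffx flux_term) t x =
  ev (diffx (diffx u_term)) t x.
Proof.
move=> t1; have := s_gt0 x t1; rewrite /= => s0.
rewrite !powRB1//; field; by rewrite (gt_eqF s0).
Qed.

Lemma pde t x : 0 <= t < 1 ->
  dt (ev u_term) t x + dx (fun s y => ev b_term s y * ev u_term s y) t x =
  dx (dx (ev u_term)) t x.
Proof.
move=> t01.
rewrite (@dtE _ _ u_term)//; last exact: u_pos_bases.
rewrite (@dxE _ _ flux_term)//; last 2 first.
- exact: flux_pos_bases.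
- by move=> s y /andP[_ s1]; exact: fluxE.
rewrite (@dxE _ _ (diffx u_term))//; last 2 first.
- exact/pos_bases_diff/u_pos_bases.
- by move=> s y; apply: dxE => //; exact: u_pos_bases.
by apply: pde_terms; case/andP: t01.
Qed.

End Solution.

(** * Pointwise bounds by the parabolic distance *)

Section Bounds.
Context {R : realType}.
Implicit Types t x : R.

Definition par_dist t x : R := `|x| + Num.sqrt (1 - t).

Lemma par_dist_gt0 t x : t < 1 -> 0 < par_dist t x.
Proof. by move=> t1; rewrite ltr_wpDl// sqrtr_gt0 subr_gt0. Qed.

Lemma par_dist_s t x : t < 1 ->
  ev s_term t x <= par_dist t x ^+ 2 <= 2 * ev s_term t x.
Proof.
move=> t1; rewrite /par_dist /=.
have sqr_bounds (r y : R) : 0 <= r -> 0 <= y ->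
    y ^+ 2 + r ^+ 2 <= (y + r) ^+ 2 <= 2 * (y ^+ 2 + r ^+ 2).
  move=> r0 y0; have := mulr_ge0 r0 y0; have := sqr_ge0 (y - r).
  by move=> ? ?; apply/andP; split; nra.
have := sqr_bounds _ _ (sqrtr_ge0 (1 - t)) (normr_ge0 x).
rewrite sqr_sqrtr; last by rewrite subr_ge0 ltW.
by rewrite real_normK ?num_real// expr2.
Qed.

Lemma powRN_le (a y z : R) : 0 <= a -> 0 < y -> y <= z -> z `^ (- a) <= y `^ (- a).
Proof.
move=> a0 y0 yz; have z0 := lt_le_trans y0 yz.
by rewrite !powRN lef_pV2 ?posrE ?powR_gt0// ge0_ler_powR// ?nnegrE ltW.
Qed.

(** Since [8 s ^ 2 <= P <= 100 s ^ 2], the solution is comparable to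
    [s ^ (2 - 19 / 8)]. *)
Lemma u_bounds t x : t < 1 ->
  8 * ev s_term t x `^ (- (3 / 8)) <= ev u_term t x
    <= 100 * ev s_term t x `^ (- (3 / 8)).
Proof.
move=> t1; have s0 := s_gt0 x t1; have P1 := P_ge x t1; have P2 := P_le x t1.
have -> : ev u_term t x = ev P_term t x * ev s_term t x `^ (- (19 / 8)) by [].
move: (ev s_term t x) (ev P_term t x) s0 P1 P2 => s P s0 P1 P2.
have -> : s `^ (- (3 / 8)) = s ^+ 2 * s `^ (- (19 / 8)).
  rewrite -powR_mulrn ?ltW// -powRD ?(gt_eqF s0) ?implybT//.
  by congr (_ `^ _); field.
by rewrite (mulrA 8) (mulrA 100) !ler_pM2r ?powR_gt0// P1.
Qed.

(** The exponent [- (3 / 4)] of [s] becomes [- (3 / 2)] in terms of the parabolic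
    distance, written in the form [- p - 1] that has an explicit primitive. *)
Lemma sqr_u_bounds t x : t < 1 ->
  64 * par_dist t x `^ (- (1 / 2) - 1) <= ev u_term t x ^+ 2
    <= (2 * 100 ^+ 2) * par_dist t x `^ (- (1 / 2) - 1).
Proof.
move=> t1; have s0 := s_gt0 x t1; have v0 := par_dist_gt0 x t1.
have /andP[u1 u2] := u_bounds x t1; have /andP[sv vs] := par_dist_s x t1.
have -> : par_dist t x `^ (- (1 / 2) - 1) = (par_dist t x ^+ 2) `^ (- (3 / 4)).
  by rewrite -powR_mulrn ?ltW// -powRrM; congr (_ `^ _); field.
have : (par_dist t x ^+ 2) `^ (- (3 / 4)) <= ev s_term t x `^ (- (3 / 4)).
  by apply: powRN_le => //; lra.
have : (2 * ev s_term t x) `^ (- (3 / 4)) <= (par_dist t x ^+ 2) `^ (- (3 / 4)).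
  by apply: powRN_le; rewrite ?exprn_gt0//; lra.
rewrite (powRM _ (ler0n _ _) (ltW s0)).
(* The factor 2 lost in v ^ 2 <= 2 s costs at most 2 after raising to the
   power - 3 / 4. *)
have two : 1 / 2 <= 2 `^ (- (3 / 4)) :> R.
  rewrite div1r -powR_inv1// ler_powR//; lra.
have sq : ev s_term t x `^ (- (3 / 4)) = ev s_term t x `^ (- (3 / 8)) ^+ 2.
  by rewrite -powR_mulrn ?powR_ge0// -powRrM; congr (_ `^ _); field.
rewrite sq; have := powR_gt0 (- (3 / 8)) s0.
move: (ev s_term t x `^ _) (ev u_term t x) u1 u2 => q u u1 u2 q0 w1 w2.
have q2 : 0 <= q ^+ 2 by rewrite sqr_ge0.
have w3 : q ^+ 2 / 2 <= 2 `^ (- (3 / 4)) * q ^+ 2 by nra.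
by apply/andP; split; nra.
Qed.

(** The numerator of [b] is at most a multiple of [|x| tau s] and its
    denominator at least [8 s ^ 3]; then [|x| <= v] and [v ^ 4 <= 4 s ^ 2]
    turn [|x| tau / s ^ 2] into [tau v ^ (- 3)]. *)
Lemma b_bound t x : t < 1 ->
  `|ev b_term t x| <= 240 * ((1 - t) * par_dist t x `^ (- 2 - 1)).
Proof.
move=> t1; have s0 := s_gt0 x t1; have v0 := par_dist_gt0 x t1.
have P0 := P_gt0 x t1; have P1 := P_ge x t1.
have /andP[sv vs] := par_dist_s x t1.
have -> : par_dist t x `^ (- 2 - 1) = par_dist t x ^- 3.
  by rewrite -powR_invn ?ltW//; congr (_ `^ _); ring.
have -> : ev b_term t x = ev N_term t x *
  (ev s_term t x `^ (-1) * ev P_term t x `^ (-1)) by [].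
have t0 : 0 < 1 - t by lra.
have xv : `|x| <= par_dist t x by rewrite lerDl sqrtr_ge0.
have N1 : `|ev N_term t x| <= 33 / 4 * 58 * (1 - t) * par_dist t x * ev s_term t x.
  have A0 : 0 <= x * x + 58 * (1 - t) by rewrite addr_ge0 -?expr2 ?sqr_ge0 ?mulr_ge0// ltW.
  have As : x * x + 58 * (1 - t) <= 58 * (x * x + (1 - t)).
    by have := sqr_ge0 x; rewrite expr2; lra.
  have -> : `|ev N_term t x| = 33 / 4 * (`|x| * (1 - t) * (x * x + 58 * (1 - t))).
    by rewrite /= !normrM normrN (ger0_norm A0) (gtr0_norm t0) (@ger0_norm _ (33 / 4))//; lra.
  have -> : 33 / 4 * 58 * (1 - t) * par_dist t x * ev s_term t x =
      33 / 4 * (par_dist t x * (1 - t) * (58 * (x * x + (1 - t)))).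
    by rewrite /=; ring.
  rewrite ler_pM2l; last by lra.
  apply: ler_pM A0 _ As; first by rewrite mulr_ge0// ltW.
  by rewrite ler_wpM2r// ltW.
rewrite (powR_inv1 (ltW s0)) (powR_inv1 (ltW P0)) normrM [X in _ * X]ger0_norm; last first.
  by rewrite mulr_ge0// invr_ge0 ltW.
move: P0 P1 N1 sv vs s0 v0 t0.
move: (ev P_term t x) `|ev N_term t x| (ev s_term t x) (par_dist t x) (1 - t).
move=> P N s v T P0 P1 N1 sv vs s0 v0 T0.
rewrite -invfM ler_pdivrMr ?mulr_gt0//.
apply: (le_trans N1).
have -> : 240 * (T * v ^- 3) * (s * P) = (240 * T * s) * (P / v ^+ 3).
  by field; rewrite (gt_eqF v0).
(* It remains to compare 957 / 480 = 33 / 4 * 58 / 240 with 8 / 4, the lower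
   bound on P divided by the factor of v ^ 4 <= 4 s ^ 2. *)
have -> : 33 / 4 * 58 * T * v * s = (240 * T * s) * (957 / 480 * v) by field.
rewrite ler_pM2l ?mulr_gt0// ler_pdivlMr ?exprn_gt0//.
have -> : 957 / 480 * v * v ^+ 3 = 957 / 480 * (v ^+ 2) ^+ 2 by ring.
have : (v ^+ 2) ^+ 2 <= (2 * s) ^+ 2 by rewrite lerXn2r// nnegrE ?sqr_ge0//; lra.
nra.
Qed.

End Bounds.

(** * Integrals of powers *)

Section Integrals.
Context {R : realType}.
Implicit Types t x p r : R.
Local Notation mu := (@lebesgue_measure R).

Lemma powR_cvgy p : 0 < p -> z `^ p @[z --> +oo] --> +oo.
Proof.
move=> p0; apply/cvgryPge => A; near=> z.
have /le_trans : A <= (Num.max A 0) `^ (p^-1) `^ p.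
  by rewrite -powRrM mulVf ?gt_eqF// powRr1 ?le_max ?lexx ?orbT.
apply; apply: ge0_ler_powR; rewrite ?nnegrE ?powR_ge0 ?ltW//.
Unshelve. all: by end_near. Qed.

Lemma powRN_cvgy p : 0 < p -> (1 - t) `^ (- p) @[t --> 1^'-] --> +oo.
Proof.
move=> p0.
have -> : (fun t => (1 - t) `^ (- p)) = (fun t => (1 - t) `^ p)\^-1.
  by apply/funext => t; rewrite /= powRN.
apply/cvgrVy; first by near=> t; rewrite powR_gt0// subr_gt0.
apply: (@cvg_comp _ _ _ (fun t => 1 - t) (fun z => z `^ p) _ (0^'+)); last first.
  exact: powR_cvg0.
move=> A [e /= e0 eA]; exists e => //= y ye y1; apply: eA => /=.
  by move: ye; rewrite /ball/= sub0r normrN.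
by rewrite subr_gt0.
Unshelve. all: by end_near. Qed.

Lemma powRN_cvg0 p : 0 < p -> z `^ (- p) @[z --> +oo] --> 0.
Proof.
move=> p0.
have -> : (fun z : R => z `^ (- p)) = (fun z => z `^ p)\^-1.
  by apply/funext => z; rewrite /= powRN.
apply/gtr0_cvgV0; last exact: powR_cvgy.
near=> z; rewrite powR_gt0//; near: z; exact: nbhs_pinfty_gt.
Unshelve. all: by end_near. Qed.

(** By symmetry the integral is twice the one over the half-line, where
    [- p ^-1 * (x + r) ^ (- p)] is a primitive vanishing at infinity. *)
Lemma integral_abs_powR p r : 0 < p -> 0 < r ->
  (\int[mu]_x ((`|x| + r) `^ (- p - 1))%:E = (2 / p * r `^ (- p))%:E)%E.
Proof.
move=> p0 r0.
have vr x : 0 < `|x| + r by rewrite ltr_wpDl.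
have cabs : continuous (fun x => (`|x| + r) `^ (- p - 1)).
  move=> x; apply: (@continuous_comp _ _ _ (fun x => `|x| + r)
    (fun z => z `^ (- p - 1))).
    by apply: cvgD; [exact: norm_continuous|exact: cvg_cst].
  exact: continuous_powRl.
rewrite ge0_symfun_integralT//; last 2 first.
- by move=> x; exact: powR_ge0.
- by move=> x /=; rewrite normrN.
have -> : [set x : R | 0 <= x] = `[0, +oo[%classic.
  by apply/seteqP; split => x/=; rewrite in_itv/= andbT.
have dF x : 0 <= x -> is_derive x 1 (fun z => - p^-1 * (z + r) `^ (- p))
    ((x + r) `^ (- p - 1)).
  move=> x0; have xr : 0 < x + r by lra.
  have dxr : is_derive x 1 (fun z : R => z + r) 1.
    by apply: is_derive_eq (is_deriveD (is_derive_id x 1) (is_derive_cst r x 1)) _; rewrite addr0.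
  have h := @is_derive1_comp _ (fun z => z `^ (- p)) _ x _ _
    (is_derive1_powR (- p) xr) dxr.
  apply: is_derive_eq (is_deriveZ (- p^-1) h) _.
  by rewrite /GRing.scale/= mulr1; field; rewrite gt_eqF.
rewrite (@ge0_continuous_FTC2y _ _ (fun z => - p^-1 * (z + r) `^ (- p)) 0 0).
- by rewrite -EFinB -EFinM (add0r r); congr EFin; field; rewrite gt_eqF.
- by move=> x _; exact: powR_ge0.
- exact: continuous_subspaceT.
- rewrite -(mulr0 (- p^-1)); apply: cvgMr.
  apply: (@cvg_comp _ _ _ (fun z => z + r) (fun z => z `^ (- p)) _ +oo).
    exact: cvg_addrr.
  exact: powRN_cvg0.
- by move=> x /ltW /dF[].
- have [/derivable1_diffP/differentiable_continuous cF _] := dF 0 (lexx 0).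
  exact: cvg_at_right_filter.
- move=> x; rewrite in_itv/= andbT => x0.
  by rewrite derive1E; have [_ ->] := dF x (ltW x0); rewrite ger0_norm ?ltW.
Qed.

Lemma measurable_onem_powR (D : set R) p :
  measurable_fun D (fun t => (1 - t) `^ p).
Proof.
apply: measurable_funTS; apply: (measurableT_comp (measurable_powR p)).
by apply: measurable_funB; [exact: measurable_cst|exact: measurable_id].
Qed.

(** The integrand is unbounded at [1], so the fundamental theorem is applied on
    the segments [[0, 1 - 1 / (n + 2)]], and monotone convergence passes to the
    limit. *)
Lemma integral_powR_onem p : 0 < p < 1 ->
  (\int[mu]_(t in `]0%R, 1%R[) ((1 - t) `^ (- p))%:E <= ((1 - p)^-1)%:E)%E.
Proof.
move=> /andP[p0 p1].
(* Starting at 2 keeps the first segment nondegenerate. *)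
pose F n : set R := `[0%R, 1 - n.+2%:R^-1]%classic.
have Fsup : `]0%R, 1%R[%classic `<=` \bigcup_n F n.
  move=> t /=; rewrite in_itv/= => /andP[t0 t1].
  have [n nt] : exists n, (1 - t)^-1 < n%:R.
    by exists (Num.truncn ((1 - t)^-1)).+1; exact: truncnS_gt.
  exists n => //; rewrite /F/= in_itv/= (ltW t0)/= lerBrDr addrC -lerBrDr.
  rewrite -[leRHS]invrK lef_pV2 ?posrE ?invr_gt0 ?subr_gt0//.
  by rewrite (le_trans (ltW nt))// ler_nat -addn2 leq_addr.
have mf (D : set R) : measurable_fun D (fun t => ((1 - t) `^ (- p))%:E).
  by apply/measurable_EFinP; exact: measurable_onem_powR.
have mF i : measurable (F i) by exact: measurable_itv.
apply: (@le_trans _ _ (\int[mu]_(t in \bigcup_n F n) ((1 - t) `^ (- p))%:E)%E).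
  apply: ge0_subset_integral => //.
  - by apply: bigcup_measurable => *; exact: mF.
  - exact: mf.
  - by move=> t _; rewrite lee_fin powR_ge0.
have nF : nondecreasing_seq F.
  apply/nondecreasing_seqP => n; rewrite subsetEset => t; rewrite /F/=.
  rewrite !in_itv/= => /andP[-> /le_trans]; apply.
  by rewrite lerD2l lerN2 lef_pV2 ?posrE// ler_nat.
have cvgF := @ge0_nondecreasing_set_cvg_integral _ (measurableTypeR R) R F
  (fun t => ((1 - t) `^ (- p))%:E) mu nF mF (fun i => mf _)
  (fun i t _ => powR_ge0 _ _).
rewrite -(cvg_lim _ cvgF)//; apply: lime_le; first by apply/cvg_ex; eexists; exact: cvgF.
apply: nearW => n.
have dG t : t < 1 -> is_derive t 1 (fun s : R => - (1 - p)^-1 * (1 - s) `^ (1 - p))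
    ((1 - t) `^ (- p)).
  move=> t1; have t0 : 0 < 1 - t by rewrite subr_gt0.
  have d1 : is_derive t 1 (fun s : R => 1 - s) (- 1).
    by apply: is_derive_eq 
      (is_deriveB (is_derive_cst (1 : R) t 1) (is_derive_id t 1)) _;
      rewrite sub0r.
  have h := @is_derive1_comp _ (fun z => z `^ (1 - p)) _ t _ _
    (is_derive1_powR (1 - p) t0) d1.
  apply: is_derive_eq (is_deriveZ (- (1 - p)^-1) h) _.
  have -> : 1 - p - 1 = - p by ring.
  by rewrite /GRing.scale/=; field; rewrite gt_eqF// subr_gt0.
have n1 : 1 - n.+2%:R^-1 < 1 :> R by rewrite ltrBlDr ltrDl invr_gt0.
rewrite (@continuous_FTC2 _ _ (fun s : R => - (1 - p)^-1 * (1 - s) `^ (1 - p))).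
- rewrite -EFinB lee_fin subr0 powR1 mulr1 opprK gerDr mulNr oppr_le0.
  by rewrite mulr_ge0 ?powR_ge0// invr_ge0 subr_ge0 ltW.
- by rewrite subr_gt0 invf_lt1// ltr1n.
- apply: continuous_in_subspaceT => t /set_mem/=; rewrite in_itv/= => /andP[_ tn].
  have t1 : t < 1 := le_lt_trans tn n1.
  have : {for t : R, continuous (fun s : R => (1 - s) `^ (- p))}; last by [].
  move: (t : R) t1 => {tn}t t1.
  apply: (@continuous_comp R R R (fun s : R => 1 - s) (fun z : R => z `^ (- p))).
    by apply: cvgB; [exact: cvg_cst|exact: cvg_id].
  by apply: continuous_powRl; rewrite subr_gt0.
- split.
  + by move=> t; rewrite in_itv/= => /andP[_ tn]; case: (dG t (lt_trans tn n1)).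
  + have [/derivable1_diffP/differentiable_continuous cG _] := dG 0 ltr01.
    exact: cvg_at_right_filter.
  + have [/derivable1_diffP/differentiable_continuous cG _] := dG _ n1.
    exact: cvg_at_left_filter.
- move=> t; rewrite in_itv/= => /andP[_ tn].
  by rewrite derive1E; have [_ ->] := dG t (lt_trans tn n1).
Qed.

Lemma sqr_Lnorm2 (f : R -> R) : (Lnorm mu 2%:E (EFin \o f) `^ 2 =
  \int[mu]_x (f x ^+ 2)%:E)%E.
Proof.
rewrite poweR_Lnorm; last by rewrite pnatr_eq0.
apply: eq_integral => x _.
by rewrite /= powR_mulrn// real_normK ?num_real.
Qed.

(** Measurability in time of the space norm is part of the theorem of Tonelli. *)
Lemma measurable_space_norm_fin p (e : term R) :
  measurable_fun setT (space_norm p%:E (ev e)).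
Proof.
have -> : space_norm p%:E (ev e) =
    (fun t => (\int[mu]_x (`|ev e t x| `^ p)%:E) `^ p^-1)%E.
  by apply/funext => t; rewrite /space_norm unlock.
apply: (measurableT_comp (measurable_poweR _)).
apply: (@measurable_fun_fubini_tonelli_F _ _ _ _ _ mu
  (fun z : R * R => (`|ev e z.1 z.2| `^ p)%:E)); last first.
  by move=> z; rewrite lee_fin powR_ge0.
apply/measurable_EFinP.
apply: (measurableT_comp (measurable_powR p)).
exact: (measurableT_comp (@normr_measurable _ setT) (measurable_ev e)).
Qed.

End Integrals.

(** * Norms and blow-up *)

Section Norms.
Context {R : realType}.
Implicit Types t x p : R.
Local Notation mu := (@lebesgue_measure R).

Lemma measurable_ev_slice (e : term R) t : measurable_fun setT (ev e t).
Proof. exact: (measurableT_comp (measurable_ev e) (pair1_measurable t)). Qed.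

Lemma measurable_par_dist t p : measurable_fun setT (fun x => par_dist t x `^ p).
Proof.
apply: (measurableT_comp (measurable_powR p)); apply: measurable_funD.
- exact: normr_measurable.
- exact: measurable_cst.
Qed.

Lemma integral_par_dist c t p : 0 <= c -> t < 1 -> 0 < p ->
  (\int[mu]_x (c * par_dist t x `^ (- p - 1))%:E =
    (c * (2 / p * (1 - t) `^ (- (p / 2))))%:E)%E.
Proof.
move=> c0 t1 p0; have t0 : 0 < 1 - t by rewrite subr_gt0.
under eq_integral do rewrite EFinM.
rewrite ge0_integralZl//; last 2 first.
- by apply/measurable_EFinP; exact: measurable_par_dist.
- by move=> x _; rewrite lee_fin powR_ge0.
rewrite integral_abs_powR ?sqrtr_gt0// -EFinM; congr (_ * (_ * _))%:E.
by rewrite -powR12_sqrt ?ltW// -powRrM; congr (_ `^ _); field.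
Qed.

(** The lower bound drives the blow-up of the norm; the upper one, integrable in
    time, keeps [u] in [L^2] of space-time. *)
Lemma energy_bounds t : t < 1 ->
  ((256 * (1 - t) `^ (- (1 / 4)))%:E <= \int[mu]_x (ev u_term t x ^+ 2)%:E
   <= ((8 * 100 ^+ 2) * (1 - t) `^ (- (1 / 4)))%:E)%E.
Proof.
move=> t1.
have mu2 : measurable_fun setT (fun x => (ev u_term t x ^+ 2)%:E).
  by apply/measurable_EFinP/measurable_funX; exact: measurable_ev_slice.
have mv c : measurable_fun setT (fun x => (c * par_dist t x `^ (- (1 / 2) - 1))%:E).
  apply/measurable_EFinP/measurable_funM; first exact: measurable_cst.
  exact: measurable_par_dist.
have intE c : 0 <= c -> ((c * 4 * (1 - t) `^ (- (1 / 4)))%:E =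
    \int[mu]_x (c * par_dist t x `^ (- (1 / 2) - 1))%:E)%E.
  move=> c0; rewrite integral_par_dist//.
  have -> : 1 / 2 / 2 = 1 / 4 :> R by field.
  by congr EFin; field.
have -> : 256 = 64 * 4 :> R by ring.
have -> : (8 * 100 ^+ 2) = (2 * 100 ^+ 2) * 4 :> R by ring.
rewrite !intE//; apply/andP; split; apply: ge0_le_integral => //.
- by move=> x _; rewrite lee_fin mulr_ge0// powR_ge0.
- exact: mv.
- by move=> x _; rewrite lee_fin; case/andP: (sqr_u_bounds x t1).
- by move=> x _; rewrite lee_fin sqr_ge0.
- exact: mv.
- by move=> x _; rewrite lee_fin; case/andP: (sqr_u_bounds x t1).
Qed.

(** The factor [1 - t] of the bound on [b] is exactly compensated by
    [2 / 2 * (1 - t) ^ (- 1)], the integral of [v ^ (- 3)]: this is the scale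
    invariance of the [L^1] norm. *)
Lemma b_norm t : t < 1 -> (space_norm 1 (ev b_term) t <= 240%:E)%E.
Proof.
move=> t1; rewrite /space_norm Lnorm1.
have t0 : 0 < 1 - t by rewrite subr_gt0.
have -> : 240%:E = (\int[mu]_x (240 * (1 - t) * par_dist t x `^ (- 2 - 1))%:E)%E.
  rewrite integral_par_dist//; last by rewrite mulr_ge0// ltW.
  rewrite divff ?mul1r ?pnatr_eq0// powR_inv1 ?ltW//.
  by congr EFin; field; rewrite gt_eqF.
apply: ge0_le_integral => //.
- apply/measurable_EFinP; apply: (measurableT_comp (@normr_measurable _ setT)).
  exact: measurable_ev_slice.
- apply/measurable_EFinP/measurable_funM; first exact: measurable_cst.
  exact: measurable_par_dist.
- by move=> x _; rewrite lee_fin -mulrA b_bound.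
Qed.

Lemma b_LooL1 : in_LrLq +oo%E 1%E (ev (@b_term R)).
Proof.
split.
- by apply: measurable_funTS; exact: measurable_ev.
- by apply: measurable_funTS; exact: measurable_space_norm_fin.
- rewrite unlock; case: ifP => // _.
  apply: (@le_lt_trans _ _ 240%:E); last exact: ltry.
  apply/ess_supP; apply: nearW => t; rewrite /= patchE.
  case: ifPn => [|_]; last by rewrite abse0 lee_fin.
  move=> /set_mem/=; rewrite in_itv/= => /andP[_ t1].
  by rewrite gee0_abs ?Lnorm_ge0// b_norm.
Qed.

Lemma u_L2L2 : in_LrLq 2%:E 2%:E (ev (@u_term R)).
Proof.
split.
- by apply: measurable_funTS; exact: measurable_ev.
- by apply: measurable_funTS; exact: measurable_space_norm_fin.
- rewrite unlock; apply: poweR_lty.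
  have -> : (\int[mu]_t `|(space_norm 2%:E (ev u_term) \_ `]0%R, 1%R[) t| `^ 2 =
      \int[mu]_(t in `]0%R, 1%R[) \int[mu]_x (ev u_term t x ^+ 2)%:E)%E.
    rewrite [RHS]integral_mkcond; apply: eq_integral => t _.
    rewrite !patchE; case: ifPn => _.
      by rewrite gee0_abs ?Lnorm_ge0// sqr_Lnorm2.
    by rewrite abse0 poweR0r// pnatr_eq0.
  apply: (@le_lt_trans _ _ (\int[mu]_(t in `]0%R, 1%R[)
    ((8 * 100 ^+ 2) * (1 - t) `^ (- (1 / 4)))%:E)%E).
    apply: ge0_le_integral => //.
    + by move=> t _; apply: integral_ge0 => x _; rewrite lee_fin sqr_ge0.
    + have -> : (fun t => \int[mu]_x (ev u_term t x ^+ 2)%:E)%E =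
          (fun t => space_norm 2%:E (ev u_term) t `^ 2)%E.
        by apply/funext => t; rewrite -sqr_Lnorm2.
      apply: measurable_funTS; apply: (measurableT_comp (measurable_poweR _)).
      exact: measurable_space_norm_fin.
    + apply/measurable_EFinP/measurable_funM; first exact: measurable_cst.
      exact: measurable_onem_powR.
    + by move=> t /=; rewrite in_itv/= => /andP[_ t1]; case/andP: (energy_bounds t1).
  under eq_integral do rewrite EFinM.
  rewrite ge0_integralZl//; last 2 first.
  + by apply/measurable_EFinP; exact: measurable_onem_powR.
  + by move=> x _; rewrite lee_fin powR_ge0.
  apply: lte_mul_pinfty => //.
  apply: le_lt_trans (ltry _); apply: integral_powR_onem; lra.
Qed.

(** At time [0] one has [s >= 1], so the negative power of [s] is at most [1]. *)
Lemma u0_bounded x : `|ev u_term 0 x| <= 100.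
Proof.
have /andP[u1 u2] := u_bounds x (@ltr01 R).
have s1 : 1 <= ev s_term 0 x by rewrite /= subr0 lerDr -expr2 sqr_ge0.
have q0 : 0 <= ev s_term 0 x `^ (- (3 / 8)) by exact: powR_ge0.
have q1 : ev s_term 0 x `^ (- (3 / 8)) <= 1.
  apply: (@le_trans _ _ (1 `^ (- (3 / 8)))); last by rewrite powR1.
  by apply: powRN_le => //; lra.
by rewrite ger0_norm; lra.
Qed.

Lemma u0_L2 : ev u_term 0 \in Lfun mu 2%:E.
Proof.
rewrite inE; apply/andP; split; rewrite inE.
  exact: measurable_ev_slice.
rewrite /finite_norm; apply: (@lty_poweRy _ _ 2); first by rewrite pnatr_eq0.
rewrite sqr_Lnorm2; have /andP[_ /le_lt_trans] := energy_bounds (@ltr01 R).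
by apply; exact: ltry.
Qed.

Lemma u0_Loo : ev u_term 0 \in Lfun mu +oo%E.
Proof.
rewrite inE; apply/andP; split; rewrite inE.
  exact: measurable_ev_slice.
have : (Lnorm mu +oo (EFin \o ev u_term 0) < +oo)%E; last by [].
rewrite unlock; case: ifP => // _.
apply: (@le_lt_trans _ _ 100%:E); last exact: ltry.
by apply/ess_supP; apply: nearW => x; rewrite /= lee_fin u0_bounded.
Qed.

Lemma limf_esup_cvgy (f : R -> R) (F : set_system R) : ProperFilter F ->
  f @ F --> +oo -> limf_esup (fun t => (f t)%:E) F = +oo%E.
Proof.
move=> FF /cvgryPge fy; rewrite limf_esupE.
apply/eqP; rewrite eq_le leey/=; apply: le_ereal_inf_tmp => _ /= [V FV <-].
rewrite leye_eq; apply/eqP/eqyP => A A0.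
have [t [Vt ft]] := filter_ex (filterI FV (fy A)).
apply: (@le_trans _ _ (f t)%:E); first by rewrite lee_fin.
by apply: ereal_sup_ubound; exists t.
Qed.

Lemma u_limsup : limf_esup (fun t => (ev u_term t 0)%:E) (1 : R)^'- = +oo%E.
Proof.
apply: limf_esup_cvgy.
apply: (@ger_cvgy _ _ _ _ (fun t => 8 * (1 - t) `^ (- (3 / 8)))).
  near=> t; have t1 : t < 1 by [].
  by have /andP[+ _] := u_bounds 0 t1; rewrite [ev s_term t 0]/= mulr0 add0r.
by apply: gt0_cvgMry => //; apply: powRN_cvgy.
Unshelve. all: by end_near. Qed.

Lemma u_norm_ge t : t < 1 ->
  ((16 * (1 - t) `^ (- (1 / 8)))%:E <= Lnorm mu 2%:E (EFin \o ev u_term t))%E.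
Proof.
move=> t1; have t0 : 0 < 1 - t by rewrite subr_gt0.
have -> : (Lnorm mu 2%:E (EFin \o ev u_term t) =
    (\int[mu]_x (ev u_term t x ^+ 2)%:E) `^ 2^-1)%E.
  by rewrite -sqr_Lnorm2 -poweRrM divff ?pnatr_eq0// poweRe1// Lnorm_ge0.
have -> : ((16 * (1 - t) `^ (- (1 / 8)))%:E =
    (256 * (1 - t) `^ (- (1 / 4)))%:E `^ 2^-1)%E.
  rewrite poweR_EFin powRM ?powR_ge0//; congr (_ * _)%:E.
    have -> : 256 = 16 ^+ 2 :> R by ring.
    by rewrite -powR_mulrn// -powRrM divff ?pnatr_eq0// powRr1.
  by rewrite -powRrM; congr (_ `^ _); field.
have /andP[E1 _] := energy_bounds t1.
apply: gt0_ler_poweR => //.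
- by rewrite in_itv/= leey andbT lee_fin mulr_ge0// powR_ge0.
- rewrite in_itv/= leey andbT; apply: integral_ge0 => x _.
  by rewrite lee_fin sqr_ge0.
Qed.

Lemma u_norm_cvgy :
  Lnorm mu 2%:E (EFin \o ev u_term t) @[t --> (1 : R)^'-] --> +oo%E.
Proof.
apply/cvgeyPge => A.
have /cvgryPge/(_ A) : 16 * (1 - t) `^ (- (1 / 8)) @[t --> (1 : R)^'-] --> +oo.
  by apply: gt0_cvgMry => //; apply: powRN_cvgy.
move=> lb; near=> t; have t1 : t < 1 by [].
apply: le_trans (u_norm_ge t1); rewrite lee_fin.
near: t; exact: lb.
Unshelve. all: by end_near. Qed.

End Norms.

Theorem theorem5p1 (R : realType) :
  exists b u : R -> R -> R,
    (in_LrLq +oo%E 1%E b /\ smooth01 b) /\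
    (smooth01 u /\ in_LrLq 2%:E 2%:E u) /\
    (forall t x : R, 0 <= t < 1 ->
       dt u t x + dx (fun s y => b s y * u s y) t x = dx (dx u) t x) /\
    [/\ u 0 \in Lfun (@lebesgue_measure R) 2%:E,
        u 0 \in Lfun (@lebesgue_measure R) +oo%E
      & smooth (u 0)] /\
    limf_esup (fun t : R => (u t 0)%:E) (1 : R)^'- = +oo%E /\
    Lnorm (@lebesgue_measure R) 2%:E (EFin \o u t) @[t --> (1 : R)^'-]
      --> +oo%E.
Proof.
exists (ev b_term), (ev u_term); split; [|split; [|split; [|split; [|split]]]].
- split; first exact: b_LooL1.
  by move=> n; apply: Cn01_ev b_pos_bases _.
- split; last exact: u_L2L2.
  by move=> n; apply: Cn01_ev u_pos_bases _.
- exact: pde.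
- split; [exact: u0_L2|exact: u0_Loo|exact: smooth_ev u_pos_bases ltr01].
- exact: u_limsup.
- exact: u_norm_cvgy.
Qed.
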